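(* Let $r\in[0,+\infty)$. Then: (a) The sequences $\{a_n(r)\}_{n\ge1}$ and $\{b_n(r)\}_{n\ge1}$ satisfy $0\le a_n(r)<a_{n+1}(r)<\cdots<b_{n+1}(r)<b_n(r)\le 1/\Gamma(r+1)$ for all $n\in\mathbb{N}$. (b) The sequences $\{a_n(r)\}$ and $\{b_n(r)\}$ converge to a common limit, denoted $\overline{\gamma}_{h^{(r)}}$, i.e. $\overline{\gamma}_{h^{(r)}}=\lim_{n\to\infty}a_n(r)=\lim_{n\to\infty}b_n(r)$. (c) For each $n\in\mathbb{N}$, $C(n,r)<\overline{\gamma}_{h^{(r)}}-a_n(r)<C(n,r)+\dfrac{h_{n+1}^{(r)}}{(n+1)^{\overline{r}}}$ and $D(n,r)-\dfrac{h_{n+1}^{(r)}}{(n+1)^{\overline{r}}}<b_n(r)-\overline{\gamma}_{h^{(r)}}<D(n,r)$, where $C(n,r)=h_n^{(r)}/n^{\overline{r}}-\int_n^{n+1}\big(h_x^{(r)}/x^{\overline{r}}\big)\,dx$ and $D(n,r)=\int_n^{n+1}\big(h_x^{(r)}/x^{\overline{r}}\big)\,dx$. (d) For $r\ge1$, $\overline{\gamma}_{h^{(r)}}>\overline{\gamma}_{h^{(r+1)}}$.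
   Context: The hyperharmonic numbers are defined by $h_n^{(0)}=1/n$ and $h_n^{(r)}=\sum_{k=1}^n h_k^{(r-1)}$ for $n,r\in\mathbb{N}$. Their analytic extension is $h_x^{(r)}=\dfrac{x^{\overline{r}}}{x\,\Gamma(r)}\big(\psi(x+r)-\psi(r)\big)$, where $x^{\overline{r}}=\Gamma(x+r)/\Gamma(x)$ is the rising factorial, $\Gamma$ is Euler's gamma function and $\psi=\Gamma'/\Gamma$ is the digamma function; for $r=0$ one uses $h_x^{(0)}=1/x$ (the limit as $r\to0$). Define, for $n\in\mathbb{N}$, $a_n(r)=\sum_{k=1}^{n-1}\dfrac{h_k^{(r)}}{k^{\overline{r}}}-\int_1^n\dfrac{h_x^{(r)}}{x^{\overline{r}}}\,dx$ and $b_n(r)=\sum_{k=1}^{n}\dfrac{h_k^{(r)}}{k^{\overline{r}}}-\int_1^n\dfrac{h_x^{(r)}}{x^{\overline{r}}}\,dx$. *)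

(* Defs.v *)
From HB Require Import structures.
From mathcomp Require Import all_boot all_order all_algebra.
From mathcomp Require Import all_classical all_reals all_analysis.
Import Order.TTheory GRing.Theory Num.Theory.
Import numFieldNormedType.Exports.

Set Implicit Arguments.
Unset Strict Implicit.
Unset Printing Implicit Defensive.

Local Open Scope classical_set_scope.
Local Open Scope ring_scope.

Section Hyperharmonic.
Context {R : realType}.
Implicit Types (x r : R) (n : nat).

(* Euler's integral; it is the gamma function for x > 0 only, and no other
   argument matters below. *)
Definition Gamma x : R :=
  \int[@lebesgue_measure R]_(t in `]0, +oo[) (t `^ (x - 1) * expR (- t)).

Definition digamma x : R := derive1 Gamma x / Gamma x.

Definition rising x r : R := Gamma (x + r) / Gamma x.

(* The analytic extension of the hyperharmonic numbers h_n^(r), which are given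
   for natural r by h_n^(0) = 1/n and h_n^(r) = \sum_(1 <= k < n.+1) h_k^(r-1).
   At r = 0 the closed form is meaningless (Gamma and digamma have a pole) and
   its limit 1/x is used. *)
Definition hyperharmonic r x : R :=
  if r == 0 then x^-1
  else rising x r / (x * Gamma r) * (digamma (x + r) - digamma r).

Definition hratio r x : R := hyperharmonic r x / rising x r.

Definition hratio_int r (u v : R) : R :=
  \int[@lebesgue_measure R]_(x in `[u, v]) hratio r x.

(* The sequences are meant for n >= 1; the value at n = 0 is irrelevant. *)
Definition a_seq r n : R :=
  \sum_(1 <= k < n) hratio r k%:R - hratio_int r 1 n%:R.

Definition b_seq r n : R :=
  \sum_(1 <= k < n.+1) hratio r k%:R - hratio_int r 1 n%:R.

Definition gamma_h r : R := lim (a_seq r n @[n --> \oo]).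

Definition C_gap n r : R := hratio r n%:R - hratio_int r n%:R n.+1%:R.

Definition D_gap n r : R := hratio_int r n%:R n.+1%:R.

End Hyperharmonic.

(* Main.v *)
(* For r > 0 the function to be summed is
     hratio r x = (psi (x + r) - psi r) / (x * Gamma r),
   i.e. a slope of the digamma function psi, and hratio 0 x = 1 / x.  The
   tangent inequality Gamma (x + s) >= Gamma x * exp (s * psi x), obtained by
   integrating e^u >= 1 + u, shows that psi is nondecreasing; with
   psi (x + 1) = psi x + 1/x this yields the expansion
     (psi (x + r) - psi r) / x = \sum_k 1 / ((r + k) * (x + r + k)),
   so hratio r is strictly decreasing, and it tends to 0 along the integers.
   Parts (a)-(c) then hold for every such function in place of hratio r.  For
   (d) with r >= 1,
     Gamma r * (hratio r x - hratio (r + 1) x)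
       = (1 - 1/r) * (psi (x + r) - psi r) / x + 1 / (r^2 * (x + r))
   is again strictly decreasing to 0, so its Euler-type constant is positive. *)
Require Import Defs.
From mathcomp Require Import all_boot all_order all_algebra.
From mathcomp Require Import all_classical all_reals all_analysis.
From mathcomp Require Import measurable_realfun ring lra.
Import Order.TTheory GRing.Theory Num.Theory.
Import numFieldNormedType.Exports.
Local Open Scope classical_set_scope.
Local Open Scope ring_scope.

Set Implicit Arguments.
Unset Strict Implicit.
Unset Printing Implicit Defensive.

(** * Sums and integrals of decreasing functions *)

Section DecreasingFunctions.
Context {R : realType}.
Notation mu := (@lebesgue_measure R).
Implicit Types f g : R -> R.

Definition decreasing_from1 f := forall x y, 1 <= x -> x < y -> f y < f x.

Lemma decreasing_from1_le f x y :
  decreasing_from1 f -> 1 <= x -> x <= y -> f y <= f x.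
Proof.
by move=> df x1; rewrite le_eqVlt => /predU1P[->//|xy]; exact/ltW/df.
Qed.

Lemma decreasing_from1_integrable f a b : decreasing_from1 f -> 1 <= a ->
  mu.-integrable `[a, b] (EFin \o f).
Proof.
move=> df a1; apply: measurable_bounded_integrable => //.
- by rewrite /= lebesgue_measure_itv/=; case: ifPn => _; rewrite ltry.
(* Monotonicity of [f] is known only from 1 on; composing with [Num.max a] gives a function that is
   nonincreasing on the whole line and agrees with [f] on [[a, b]]. *)
- have fmax : nonincreasing_fun (fun x => f (Num.max a x)).
    move=> x y xy; apply: decreasing_from1_le => //.
      by rewrite le_max a1.
    by rewrite ge_max !le_max lexx/= xy orbT.
  apply: (eq_measurable_fun (fun x => f (Num.max a x))).
    by move=> x /[!inE]/=; rewrite in_itv/= => /andP[/max_r ->].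
  exact: nonincreasing_measurable.
- exists (`|f a| + `|f b|); split; first by rewrite num_real.
  move=> M fM x /=; rewrite in_itv/= => /andP[ax xb].
  apply/ltW/(le_lt_trans _ fM).
  have := decreasing_from1_le df a1 ax.
  have := decreasing_from1_le df (le_trans a1 ax) xb.
  by rewrite ler_norml; have := ler_norm (f a); have := ler_norm (- f b);
    have := normr_ge0 (f a); have := normr_ge0 (f b); rewrite normrN; lra.
Qed.

Lemma Rintegral_itv_split f a b c : decreasing_from1 f -> 1 <= a ->
  a <= b -> b <= c ->
  \int[mu]_(x in `[a, c]) f x =
  \int[mu]_(x in `[a, b]) f x + \int[mu]_(x in `[b, c]) f x.
Proof.
move=> df a1 ab bc.
have -> : \int[mu]_(x in `[b, c]) f x = \int[mu]_(x in `]b, c]) f x.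
  rewrite Rintegral_itv_obnd_cbnd//.
  apply: (@integrableS _ _ _ mu `[b, c]) => //.
    by apply: subset_itvr; rewrite bnd_simp.
  by apply: decreasing_from1_integrable => //; exact: le_trans ab.
rewrite -(@Rintegral_itvB _ f (BLeft a) (BRight c) b) ?bnd_simp//; first by lra.
exact: decreasing_from1_integrable.
Qed.

Lemma decreasing_Rintegral_bounds f a b : decreasing_from1 f -> 1 <= a ->
  a <= b -> (b - a) * f b <= \int[mu]_(x in `[a, b]) f x <= (b - a) * f a.
Proof.
move=> df a1 ab.
have cstE c : \int[mu]_(x in `[a, b]) c = (b - a) * c.
  rewrite Rintegral_cst//= lebesgue_measure_itv/= mulrC.
  by case: ifPn => //=; rewrite lte_fin -leNgt; move: ab => /[swap] ba ab;
    rewrite (_ : a = b) ?subrr//; lra.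
have icst c : mu.-integrable `[a, b] (EFin \o (fun=> c)).
  apply: measurable_bounded_integrable => //.
    by rewrite /= lebesgue_measure_itv/=; case: ifPn => _; rewrite ltry.
  exact: bounded_cst.
have iF := decreasing_from1_integrable b df a1.
rewrite -!cstE; apply/andP; split; apply: le_Rintegral => // x /=;
  rewrite in_itv/= => /andP[ax xb].
- by apply: decreasing_from1_le => //; exact: le_trans ax.
- exact: decreasing_from1_le.
Qed.

(** Strictness comes from cutting at the midpoint: each half obeys the weak bounds, and the value of
    [f] at the midpoint lies strictly between those at the ends. *)
Lemma decreasing_Rintegral_unit f a : decreasing_from1 f -> 1 <= a ->
  f (a + 1) < \int[mu]_(x in `[a, a + 1]) f x < f a.
Proof.
move=> df a1.
rewrite (@Rintegral_itv_split f a (a + 2^-1) (a + 1))//; [|lra..].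
have h1 : a + 2^-1 < a + 1 by lra.
have a2 : 1 <= a + 2^-1 by lra.
have := decreasing_Rintegral_bounds df a1 (ltac:(lra) : a <= a + 2^-1).
have := decreasing_Rintegral_bounds df a2 (ltW h1).
have := df _ _ a1 (ltac:(lra) : a < a + 2^-1).
have := df _ _ a2 h1.
lra.
Qed.

(** * Sum minus integral: the Euler-type sequences of a decreasing function *)

Definition lower_seq f n : R :=
  \sum_(1 <= k < n) f k%:R - \int[mu]_(x in `[1, n%:R]) f x.

Definition upper_seq f n : R :=
  \sum_(1 <= k < n.+1) f k%:R - \int[mu]_(x in `[1, n%:R]) f x.

Lemma lower_seq1 f : lower_seq f 1 = 0.
Proof. by rewrite /lower_seq big_geq// set_itv1 Rintegral_set1 subrr. Qed.

Lemma upper_seqE f n : (1 <= n)%N -> upper_seq f n = lower_seq f n + f n%:R.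
Proof. by move=> n1; rewrite /upper_seq big_nat_recr//= addrAC. Qed.

Lemma lower_seqS f n : decreasing_from1 f -> (1 <= n)%N ->
  lower_seq f n.+1 =
  lower_seq f n + f n%:R - \int[mu]_(x in `[n%:R, n.+1%:R]) f x.
Proof.
move=> df n1; rewrite -upper_seqE// /lower_seq /upper_seq.
rewrite (@Rintegral_itv_split f 1 n%:R) ?ler1n ?ler_nat//.
by rewrite opprD addrA.
Qed.

Section Limit.
Context (f : R -> R) (df : decreasing_from1 f).
Context (f0 : f n%:R @[n --> \oo] --> 0).

Lemma decreasing_Rintegral_nat n : (1 <= n)%N ->
  f n.+1%:R < \int[mu]_(x in `[n%:R, n.+1%:R]) f x < f n%:R.
Proof.
by move=> n1; rewrite -natr1; apply: decreasing_Rintegral_unit; rewrite ?ler1n.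
Qed.

(** For large [m], [f m <= f (n + 1)]; letting [m] grow gives [0 <= f (n + 1)], and one strict step
    back to [n] finishes. *)
Lemma decreasing_cvg0_gt0 n : (1 <= n)%N -> 0 < f n%:R.
Proof.
move=> n1.
have fS : f n.+1%:R < f n%:R by apply: df; rewrite ?ler1n ?ltr_nat.
apply: le_lt_trans fS.
apply: (cvgr_to_le f0); near=> m.
apply: decreasing_from1_le => //; rewrite ?ler1n// ler_nat.
by near: m; exact: nbhs_infty_ge.
Unshelve. all: by end_near. Qed.

Lemma lower_seq_lt n : (1 <= n)%N -> lower_seq f n < lower_seq f n.+1.
Proof.
move=> n1; rewrite lower_seqS//.
by have /andP[_] := decreasing_Rintegral_nat n1; lra.
Qed.

Lemma upper_seq_lt n : (1 <= n)%N -> upper_seq f n.+1 < upper_seq f n.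
Proof.
move=> n1; rewrite !upper_seqE// lower_seqS//.
by have /andP[+ _] := decreasing_Rintegral_nat n1; lra.
Qed.

Lemma lower_seq_le m n : (1 <= m)%N -> (m <= n)%N ->
  lower_seq f m <= lower_seq f n.
Proof.
move=> m1 /subnK <-; elim: (n - m)%N => [//|k /le_trans]; apply; apply/ltW.
by rewrite addSn lower_seq_lt// addn_gt0 m1 orbT.
Qed.

Lemma upper_seq_le m n : (1 <= m)%N -> (m <= n)%N ->
  upper_seq f n <= upper_seq f m.
Proof.
move=> m1 /subnK <-; elim: (n - m)%N => [//|k]; apply: le_trans; apply/ltW.
by rewrite addSn upper_seq_lt// addn_gt0 m1 orbT.
Qed.

(** Both sides are moved to the common index [maxn m n], where they differ by a positive value of
    [f]. *)
Lemma lower_lt_upper m n : (1 <= m)%N -> (1 <= n)%N ->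
  lower_seq f m < upper_seq f n.
Proof.
move=> m1 n1; have mn : (1 <= maxn m n)%N by rewrite leq_max m1.
apply: (le_lt_trans (lower_seq_le m1 (leq_maxl m n))).
apply: (lt_le_trans _ (upper_seq_le n1 (leq_maxr m n))).
by rewrite upper_seqE// ltrDl decreasing_cvg0_gt0.
Qed.

Lemma lower_seq_cvg : lower_seq f n @[n --> \oo] --> lim (lower_seq f @ \oo).
Proof.
(* Monotonicity starts at index 1, so monotone convergence is applied to the shifted sequence. *)
suff: cvgn (fun n => lower_seq f n.+1).
  move=> /cvg_ex[l hl]; have hl' : lower_seq f n @[n --> \oo] --> l.
    by rewrite -(cvg_shiftS (lower_seq f)).
  by rewrite (cvg_lim _ hl').
apply: nondecreasing_is_cvgn.
  by apply/nondecreasing_seqP => n; exact/ltW/lower_seq_lt.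
by exists (upper_seq f 1) => _ [n _ <-]; exact/ltW/lower_lt_upper.
Qed.

Lemma upper_seq_cvg : upper_seq f n @[n --> \oo] --> lim (lower_seq f @ \oo).
Proof.
rewrite -[X in _ --> X]addr0.
apply: cvg_trans (cvgD lower_seq_cvg f0); apply: near_eq_cvg; near=> n.
rewrite /= fctE upper_seqE//.
by near: n; exact: nbhs_infty_ge.
Unshelve. all: by end_near. Qed.

(** The strict step from [n] to [n.+1] is what keeps the inequality strict when passing to the
    limit. *)
Lemma lower_seq_lt_lim n : (1 <= n)%N ->
  lower_seq f n < lim (lower_seq f @ \oo).
Proof.
move=> n1; apply: (lt_le_trans (lower_seq_lt n1)).
apply: (cvgr_to_ge lower_seq_cvg); near=> m.
by apply: lower_seq_le => //; near: m; exact: nbhs_infty_ge.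
Unshelve. all: by end_near. Qed.

Lemma lim_lt_upper_seq n : (1 <= n)%N ->
  lim (lower_seq f @ \oo) < upper_seq f n.
Proof.
move=> n1; apply: (le_lt_trans _ (upper_seq_lt n1)).
apply: (cvgr_to_le upper_seq_cvg); near=> m.
by apply: upper_seq_le => //; near: m; exact: nbhs_infty_ge.
Unshelve. all: by end_near. Qed.

End Limit.

Lemma lower_seqB f g n : decreasing_from1 f -> decreasing_from1 g ->
  lower_seq (fun x => f x - g x) n = lower_seq f n - lower_seq g n.
Proof.
move=> df dg; rewrite /lower_seq sumrB RintegralB//;
  [|exact: decreasing_from1_integrable..].
lra.
Qed.

(** The lower sequence of [f - g] is 0 at index 1 and strictly increasing, so its limit is positive;
    by linearity this limit is the difference of the two limits. *)
Lemma lim_lower_seq_lt f g : decreasing_from1 f -> decreasing_from1 g ->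
  decreasing_from1 (fun x => f x - g x) ->
  f n%:R @[n --> \oo] --> 0 -> g n%:R @[n --> \oo] --> 0 ->
  lim (lower_seq g @ \oo) < lim (lower_seq f @ \oo).
Proof.
move=> df dg dfg f0 g0.
have fg0 : f n%:R - g n%:R @[n --> \oo] --> 0.
  by have := cvgB f0 g0; rewrite subr0; apply.
have := lower_seq_lt_lim dfg fg0 (leqnn 1).
rewrite lower_seq1 -[in X in _ -> X]subr_gt0.
suff -> : lim (lower_seq (fun x => f x - g x) @ \oo) =
  lim (lower_seq f @ \oo) - lim (lower_seq g @ \oo) by [].
apply: cvg_lim; first exact: Rhausdorff.
have -> : lower_seq (fun x => f x - g x) = lower_seq f - lower_seq g.
  by apply/funext => n; rewrite lower_seqB.
by apply: cvgB; exact: lower_seq_cvg.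
Qed.

End DecreasingFunctions.

(** * Integration over the positive half-line *)

Section PositiveHalfLine.
Context {R : realType}.
Notation mu := (@lebesgue_measure R).
Notation Rpos := (`](0 : R), +oo[%classic).
Implicit Types (f F : R -> R) (a b s t : R) (n : nat).

(** Compact intervals away from 0, on which the fundamental theorem of calculus applies to functions
    that may be singular at 0. *)
Definition exhaustion n : set R := `[n.+1%:R^-1, n.+1%:R].

Lemma exhaustion_gt0 n t : exhaustion n t -> 0 < t.
Proof. by rewrite /exhaustion/= in_itv/= => /andP[+ _]; exact: lt_le_trans. Qed.

Lemma bigcup_exhaustion : \bigcup_n exhaustion n = Rpos.
Proof.
apply/seteqP; split=> t /=; rewrite in_itv/= andbT.
  by move=> [n _ /exhaustion_gt0].
move=> t0; near \oo => n; exists n => //.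
rewrite /exhaustion /= in_itv/=; apply/andP; split.
- rewrite invf_ple ?posrE// -natr1 ler_wpDr//.
  by near: n; exact: nbhs_infty_ger.
- by rewrite -natr1 ler_wpDr//; near: n; exact: nbhs_infty_ger.
Unshelve. all: by end_near. Qed.

Lemma exhaustion_subset n : exhaustion n `<=` Rpos.
Proof. by rewrite -bigcup_exhaustion; exact: bigcup_sup. Qed.

Lemma cvg_integral_exhaustion f : measurable_fun Rpos f ->
  (forall t, 0 < t -> 0 <= f t) ->
  (\int[mu]_(t in exhaustion n) (f t)%:E @[n --> \oo] -->
   \int[mu]_(t in Rpos) (f t)%:E)%E.
Proof.
move=> mf f0; rewrite -bigcup_exhaustion.
apply: ge0_nondecreasing_set_cvg_integral.
- move=> m n mn; rewrite subsetEset; apply: subset_itvScc; rewrite bnd_simp.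
    by rewrite lef_pV2 ?posrE// ler_nat.
  by rewrite ler_nat.
- by move=> n; exact: measurable_itv.
- move=> n; apply/measurable_EFinP; apply: measurable_funS mf => //.
  exact: exhaustion_subset.
- by move=> n t /exhaustion_gt0 t0; rewrite lee_fin f0.
Qed.

Lemma integral_derive_pos f F a b : 0 < a -> a < b ->
  (forall t, 0 < t -> is_derive t 1 F (f t)) ->
  (forall t, 0 < t -> {for t, continuous f}) ->
  (\int[mu]_(t in `[a, b]) (f t)%:E = (F b - F a)%:E)%E.
Proof.
move=> a0 ab dF cf.
have ab0 t : t \in `[a, b] -> 0 < t.
  by rewrite in_itv/= => /andP[+ _]; exact: lt_le_trans.
have cF : {within `[a, b], continuous F}.
  apply: derivable_within_continuous => t /ab0 t0.
  by have [] := dF _ t0.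
rewrite EFinB; apply: continuous_FTC2 => //.
- by apply: continuous_in_subspaceT => t /[!inE] /ab0 /cf.
- move/continuous_within_itvP : cF => /(_ ab)[_ ? ?]; split => //.
  by move=> t /subset_itv_oo_cc /ab0 t0; have [] := dF _ t0.
- move=> t /subset_itv_oo_cc /ab0 t0; rewrite derive1E.
  by have /@derive_val := dF _ t0.
Qed.

Lemma measurable_fun_pos f : (forall t, 0 < t -> {for t, continuous f}) ->
  measurable_fun Rpos f.
Proof.
move=> cf; apply: open_continuous_measurable_fun; first exact: interval_open.
by move=> t /[!inE]/=; rewrite in_itv/= andbT; exact: cf.
Qed.

(** On each compact interval the integral is a difference of two values of [F], hence at most [2 M];
    monotone convergence carries this bound to the half-line. *)
Lemma integrable_pos_bounded_primitive f F M :
  (forall t, 0 < t -> is_derive t 1 F (f t)) ->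
  (forall t, 0 < t -> {for t, continuous f}) ->
  (forall t, 0 < t -> 0 <= f t) ->
  (forall t, 0 < t -> `|F t| <= M) ->
  mu.-integrable Rpos (EFin \o f).
Proof.
move=> dF cf f0 FM; have mf := measurable_fun_pos cf.
apply/integrableP; split; first exact/measurable_EFinP.
have -> : (\int[mu]_(t in Rpos) `|(EFin \o f) t| =
           \int[mu]_(t in Rpos) (f t)%:E)%E.
  apply: eq_integral => t /[!inE]/=; rewrite in_itv/= andbT => t0.
  by rewrite ger0_norm ?f0.
apply: (@le_lt_trans _ _ (M + M)%:E); last exact: ltry.
have cvgf := cvg_integral_exhaustion mf f0.
rewrite -(cvg_lim _ cvgf)//; apply: lime_le.
  by apply/cvg_ex; eexists; exact: cvgf.
near=> n.
(* For [n = 0] the interval is the single point 1, whereas [integral_derive_pos] needs distinct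
   endpoints. *)
have n1 : 1 < n.+1%:R :> R by rewrite ltr1n ltnS; near: n; exact: nbhs_infty_gt.
rewrite /exhaustion (integral_derive_pos _ _ dF cf)//.
  rewrite lee_fin (le_trans (ler_norm _))// (le_trans (ler_normB _ _))//.
  by rewrite lerD// FM.
by rewrite (lt_trans _ n1)// invf_lt1.
Unshelve. all: by end_near. Qed.

Lemma cvg_Rintegral_exhaustion f :
  mu.-integrable Rpos (EFin \o f) ->
  (forall t, 0 < t -> 0 <= f t) ->
  \int[mu]_(t in exhaustion n) f t @[n --> \oo] -->
  \int[mu]_(t in Rpos) f t.
Proof.
move=> intf f0; apply: fine_cvg; rewrite fineK; last exact: integrable_fin_num.
apply: cvg_integral_exhaustion => //.
by apply/measurable_EFinP; exact: (measurable_int mu).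
Qed.

End PositiveHalfLine.

(** * The gamma function *)

Section GammaFunction.
Context {R : realType}.
Notation mu := (@lebesgue_measure R).
Notation Rpos := (`](0 : R), +oo[%classic).
Implicit Types (s t x y : R) (n : nat).

Definition gamma_fun s t : R := t `^ (s - 1) * expR (- t).

Lemma GammaE s : Gamma s = \int[mu]_(t in Rpos) gamma_fun s t.
Proof. by []. Qed.

Lemma gamma_funE s t : 0 < t -> gamma_fun s t = expR ((s - 1) * ln t - t).
Proof. by move=> t0; rewrite /gamma_fun /powR gt_eqF// -expRD. Qed.

Lemma gamma_fun_ge0 s t : 0 <= gamma_fun s t.
Proof. by rewrite mulr_ge0 ?powR_ge0 ?expR_ge0. Qed.

Lemma is_derive_gamma_fun s t : 0 < t ->
  is_derive t 1 (gamma_fun s) ((s - 1) * gamma_fun (s - 1) t - gamma_fun s t).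
Proof.
move=> t0; have dp := is_derive1_powR (s - 1) t0.
have dexp : is_derive t 1 (fun t : R => expR (- t)) (- expR (- t)).
  have := @is_derive1_comp R expR -%R t (expR (- t)) (- 1) _ _.
  by rewrite mulrN1; apply.
have dg : is_derive t 1 (gamma_fun s) _ := is_deriveM dp dexp.
apply: is_derive_eq.
by rewrite /gamma_fun /GRing.scale/=; ring.
Qed.

Lemma continuous_gamma_fun s t : 0 < t -> {for t, continuous (gamma_fun s)}.
Proof.
move=> t0; apply/differentiable_continuous/derivable1_diffP.
by have [] := is_derive_gamma_fun s t0.
Qed.

Lemma measurable_gamma_fun s : measurable_fun Rpos (gamma_fun s).
Proof. by apply: measurable_fun_pos => t; exact: continuous_gamma_fun. Qed.

(** This is [ln u <= u - 1] at [u = t / s]; the left side is maximal at [t = s]. *)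
Lemma ln_le_linear s t : 0 < s -> 0 < t -> s * ln t - t <= s * ln s - s.
Proof.
move=> s0 t0; have ts0 : 0 < t / s by rewrite divr_gt0.
have : ln (1 + (t / s - 1)) <= t / s - 1 by rewrite le_ln1Dx//; lra.
rewrite addrCA subrr addr0 ln_div ?posrE// => /(ler_wpM2l (ltW s0)).
by rewrite !mulrBr mulr1 mulrCA divff ?gt_eqF// mulr1; lra.
Qed.

Lemma integrable_gamma_fun s : 0 < s ->
  mu.-integrable Rpos (EFin \o gamma_fun s).
Proof.
move=> s0.
(* Comparison with f, which has the bounded primitive F. *)
pose F t : R := - (s * (1 + t `^ s))^-1.
pose f t : R := t `^ (s - 1) * (1 + t `^ s) ^- 2.
have den_gt0 t : 0 < 1 + t `^ s by rewrite ltr_pwDl ?powR_ge0.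
have dF t : 0 < t -> is_derive t 1 F (f t).
  move=> t0; have dp := is_derive1_powR s t0.
  have d0 : s * (1 + t `^ s) != 0 by rewrite mulf_neq0 ?gt_eqF.
  have dden : is_derive t 1 (fun t => s * (1 + t `^ s)) _ :=
    is_deriveZ s (is_deriveD (is_derive_cst (1 : R) t 1) dp).
  have dF : is_derive t 1 F _ :=
    is_deriveN (@is_deriveV _ (fun t => s * (1 + t `^ s)) _ _ _ d0 dden).
  apply: is_derive_eq; rewrite /f /GRing.scale/=; field.
  by rewrite !gt_eqF.
have cpow q t : 0 < t -> {for t, continuous (fun t => t `^ q)}.
  move=> t0; apply/differentiable_continuous/derivable1_diffP.
  by have [] := is_derive1_powR q t0.
have cf t : 0 < t -> {for t, continuous f}.
  move=> t0; apply: cvgM; first exact: cpow.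
  apply: cvgV; first by rewrite expf_neq0// gt_eqF.
  rewrite expr2 /continuous_at; under eq_fun do rewrite expr2.
  by apply: cvgM; apply: cvgD; [exact: cvg_cst|exact: cpow|exact: cvg_cst|
    exact: cpow].
have f0 t : 0 < t -> 0 <= f t.
  move=> t0; rewrite mulr_ge0 ?powR_ge0// invr_ge0.
  by rewrite exprn_ge0 ?(ltW (den_gt0 t)).
have FM t : 0 < t -> `|F t| <= s^-1.
  move=> t0; have d0 : 0 < s * (1 + t `^ s) by rewrite mulr_gt0.
  rewrite normrN ger0_norm; last by rewrite invr_ge0 ltW.
  by rewrite lef_pV2 ?posrE// ler_peMr ?(ltW s0)// lerDl powR_ge0.
have intf := integrable_pos_bounded_primitive dF cf f0 FM.
pose c := 2 + 2 * expR (2 * s * ln (2 * s) - 2 * s).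
apply: (@le_integrable _ _ _ mu _ _ _ (EFin \o (fun t => c * f t))) => //.
- by apply/measurable_EFinP; exact: measurable_gamma_fun.
- move=> t /=; rewrite in_itv/= andbT => t0.
  have c0 : 0 <= c by rewrite addr_ge0// mulr_ge0// expR_ge0.
  rewrite lee_fin ger0_norm ?gamma_fun_ge0//.
  rewrite (ger0_norm (mulr_ge0 c0 (f0 _ t0))).
  rewrite /gamma_fun /f mulrCA (ler_wpM2l (powR_ge0 _ _))//.
  rewrite ler_pdivlMr ?exprn_gt0//.
  have pE : t `^ s = expR (s * ln t) by rewrite /powR gt_eqF.
  have h1 : (1 + t `^ s) ^+ 2 <= 2 + 2 * expR (2 * s * ln t).
    have -> : expR (2 * s * ln t) = t `^ s ^+ 2.
      by rewrite pE expr2 -expRD; congr expR; ring.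
    by have := sqr_ge0 (1 - t `^ s); rewrite !expr2; lra.
  apply: (le_trans (ler_wpM2l (expR_ge0 _) h1)).
  rewrite mulrDr lerD//.
    by rewrite ler_piMl// -expR0 ler_expR; lra.
  rewrite mulrCA ler_wpM2l// -expRD ler_expR.
  by have := @ln_le_linear (2 * s) t ltac:(lra) t0; lra.
- exact: (@integrableZl _ _ _ mu Rpos (measurable_itv _) c _ intf).
Qed.

Lemma gamma_funS s t : 0 < t -> gamma_fun (s + 1) t = t * gamma_fun s t.
Proof.
move=> t0; rewrite !gamma_funE//.
rewrite -[t in RHS](lnK (_ : t \is Num.pos)) ?posrE// -expRD lnK ?posrE//.
by congr expR; ring.
Qed.

Lemma Gamma_gt0 s : 0 < s -> 0 < Gamma s.
Proof.
move=> s0; pose c := expR (- `|s - 1| - 2).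
have intg := integrable_gamma_fun s0.
have sub : `[1, 2]%classic `<=` Rpos.
  by move=> t /=; rewrite !in_itv/= andbT => /andP[t1 _]; lra.
have int12 : mu.-integrable `[1, 2] (EFin \o gamma_fun s).
  exact: integrableS intg.
apply: (@lt_le_trans _ _ c); first exact: expR_gt0.
apply: (@le_trans _ _ (\int[mu]_(t in `[1, 2]) gamma_fun s t)).
- have -> : c = \int[mu]_(t in `[1, 2]) c.
    rewrite Rintegral_cst//= lebesgue_measure_itv/= lte_fin ifT; last by lra.
    by rewrite -[X in _ * fine X]EFinB/=; lra.
  apply: le_Rintegral => //.
    apply: measurable_bounded_integrable => //.
      by rewrite /= lebesgue_measure_itv/=; case: ifPn => _; rewrite ltry.
    exact: bounded_cst.
  move=> t /=; rewrite in_itv/= => /andP[t1 t2]; have t0 : 0 < t by lra.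
  rewrite gamma_funE// ler_expR lerD//; last by lra.
  have l0 : 0 <= ln t by rewrite ln_ge0.
  have l1 : ln t <= 1.
    have := @le_ln1Dx _ (t - 1) ltac:(lra); rewrite addrC subrK; lra.
  have := ler_norm (- (s - 1)); rewrite normrN => h.
  have := normr_ge0 (s - 1); nra.
- rewrite GammaE /Rintegral fine_le//.
  + exact: integrable_fin_num.
  + exact: integrable_fin_num.
  + apply: ge0_subset_integral => //.
      by apply/measurable_EFinP; exact: measurable_gamma_fun.
    by move=> t _; rewrite lee_fin gamma_fun_ge0.
Qed.

Lemma cvg_invSn : (n.+1%:R^-1 : R) @[n --> \oo] --> 0.
Proof. exact: cvg_harmonic. Qed.

Lemma cvg_gamma_fun_Sn s : 0 < s ->
  gamma_fun (s + 1) n.+1%:R @[n --> \oo] --> 0.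
Proof.
(* [c] is the maximum of [gamma_fun (s + 2)], which equals [t * gamma_fun (s + 1) t]; this gives
   decay at least as fast as [c / t]. *)
move=> s0; pose c := expR ((s + 1) * ln (s + 1) - (s + 1)).
apply: (@squeeze_cvgr _ _ _ _ (cst 0) (fun n => c * n.+1%:R^-1)).
- near=> n; rewrite /cst gamma_fun_ge0/= ler_pdivlMr ?ltr0n// mulrC.
  rewrite -gamma_funS ?ltr0n// gamma_funE ?ltr0n// ler_expR addrK.
  by apply: ln_le_linear; [lra|rewrite ltr0n].
- exact: cvg_cst.
- by rewrite -[X in _ --> X](mulr0 c); apply: cvgMl_tmp; exact: cvg_invSn.
Unshelve. all: by end_near. Qed.

Lemma cvg_gamma_fun_invSn s : 0 < s ->
  gamma_fun (s + 1) n.+1%:R^-1 @[n --> \oo] --> 0.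
Proof.
move=> s0.
apply: (@squeeze_cvgr _ _ _ _ (cst 0) (fun n => n.+1%:R^-1 `^ s)).
- near=> n; rewrite /cst gamma_fun_ge0/= /gamma_fun addrK.
  apply: ler_piMr; first exact: powR_ge0.
  by rewrite -[leRHS]expR0 ler_expR oppr_le0 invr_ge0.
- exact: cvg_cst.
- have /cvg_at_rightP := powR_cvg0 s0; apply; split => //.
  exact: cvg_invSn.
Unshelve. all: by end_near. Qed.

(** Integration by parts: [gamma_fun (s + 1)] is a primitive of
    [s * gamma_fun s - gamma_fun (s + 1)], and its values at both ends of the exhausting intervals
    tend to 0. *)
Lemma Gamma1D s : 0 < s -> Gamma (s + 1) = s * Gamma s.
Proof.
move=> s0; have s10 : 0 < s + 1 by lra.
have c1 := cvg_Rintegral_exhaustion (integrable_gamma_fun s10)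
  (fun t _ => gamma_fun_ge0 (s + 1) t).
have c0 := cvg_Rintegral_exhaustion (integrable_gamma_fun s0)
  (fun t _ => gamma_fun_ge0 s t).
have : s * \int[mu]_(t in exhaustion n) gamma_fun s t
    - (gamma_fun (s + 1) n.+1%:R - gamma_fun (s + 1) n.+1%:R^-1)
    @[n --> \oo] --> s * Gamma s - (0 - 0).
  apply: cvgB; first by apply: cvgMl_tmp; exact: c0.
  by apply: cvgB; [exact: cvg_gamma_fun_Sn|exact: cvg_gamma_fun_invSn].
rewrite !subr0 => c2.
rewrite [LHS]GammaE -(cvg_lim (@Rhausdorff R) c1).
apply: cvg_lim; first exact: Rhausdorff.
apply: cvg_trans c2; apply: near_eq_cvg; near=> n.
have n1 : 1 < n.+1%:R :> R by rewrite ltr1n ltnS; near: n; exact: nbhs_infty_gt.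
have n0 : 0 < n.+1%:R^-1 :> R by rewrite invr_gt0 ltr0n.
have dF t : 0 < t -> is_derive t 1 (gamma_fun (s + 1))
    (s * gamma_fun s t - gamma_fun (s + 1) t).
  by move=> t0; apply: is_derive_eq; first exact: is_derive_gamma_fun;
    rewrite addrK.
have cf t : 0 < t ->
    {for t, continuous (fun t => s * gamma_fun s t - gamma_fun (s + 1) t)}.
  move=> t0; apply: cvgB; last exact: continuous_gamma_fun.
  by apply: cvgMl_tmp; exact: continuous_gamma_fun.
have int_n q : 0 < q -> mu.-integrable (exhaustion n) (EFin \o gamma_fun q).
  move=> q0; apply: integrableS (integrable_gamma_fun q0);
    [exact: measurable_itv|exact: measurable_itv|exact: exhaustion_subset].
have n2 : n.+1%:R^-1 < n.+1%:R :> R.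
  by rewrite (lt_trans _ n1)// invf_lt1// (lt_trans _ n1).
have := integral_derive_pos n0 n2 dF cf.
move/(congr1 fine) => /= <-.
rewrite -[fine _]/(\int[mu]_(t in exhaustion n)
  (s * gamma_fun s t - gamma_fun (s + 1) t)).
rewrite (@RintegralB _ _ R mu (exhaustion n));
  [|exact: measurable_itv| |exact: int_n].
- rewrite (@RintegralZl _ _ R mu (exhaustion n));
    [lra|exact: measurable_itv|exact: int_n].
- exact: (@integrableZl _ _ _ mu (exhaustion n) (measurable_itv _) s _
    (int_n _ s0)).
Unshelve. all: by end_near. Qed.

Lemma Gamma1 : Gamma (1 : R) = 1.
Proof.
have := cvg_Rintegral_exhaustion (integrable_gamma_fun ltr01)
  (fun t _ => gamma_fun_ge0 1 t).
move/(cvg_lim (@Rhausdorff R)) => E; rewrite GammaE -E {E}.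
apply: cvg_lim; first exact: Rhausdorff.
have : expR (- n.+1%:R^-1 : R) - expR (- n.+1%:R) @[n --> \oo] -->
    expR (- 0 : R) - 0.
  apply: cvgB.
    apply: continuous_cvg; first exact: continuous_expR.
    by apply: cvgN; exact: cvg_invSn.
  apply: (@squeeze_cvgr _ _ _ _ (cst 0) (fun n => n.+1%:R^-1)).
  - near=> n; rewrite /cst expR_ge0/= expRN lef_pV2 ?posrE ?expR_gt0 ?ltr0n//.
    by rewrite (le_trans _ (expR_ge1Dx _))// lerDr.
  - exact: cvg_cst.
  - exact: cvg_invSn.
rewrite oppr0 expR0 addr0; apply: cvg_trans.
apply: near_eq_cvg; near=> n.
have n1 : 1 < n.+1%:R :> R by rewrite ltr1n ltnS; near: n; exact: nbhs_infty_gt.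
have n0 : 0 < n.+1%:R^-1 :> R by rewrite invr_gt0 ltr0n.
have gE t : 0 < t -> gamma_fun 1 t = expR (- t).
  by move=> t0; rewrite /gamma_fun subrr powRr0 mul1r.
have dF t : 0 < t -> is_derive t 1 (fun t => - gamma_fun 1 t) (gamma_fun 1 t).
  move=> t0.
  have d : is_derive t 1 (fun t => - gamma_fun 1 t) _ :=
    is_deriveN (is_derive_gamma_fun 1 t0).
  by apply: is_derive_eq; rewrite subrr mul0r sub0r opprK.
have n2 : n.+1%:R^-1 < n.+1%:R :> R.
  by rewrite (lt_trans _ n1)// invf_lt1// (lt_trans _ n1).
have := integral_derive_pos n0 n2 dF
  (@continuous_gamma_fun 1).
move/(congr1 fine) => /= E; rewrite /Rintegral E !gE ?ltr0n//; lra.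
Unshelve. all: by end_near. Qed.

End GammaFunction.

(** * The digamma function *)

Section Digamma.
Context {R : realType}.
Notation mu := (@lebesgue_measure R).
Notation Rpos := (`](0 : R), +oo[%classic).
Implicit Types (s t x y : R) (n : nat).

Lemma gamma_funD x s t : 0 < t ->
  gamma_fun (x + s) t = expR (s * ln t) * gamma_fun x t.
Proof. by move=> t0; rewrite !gamma_funE// -expRD; congr expR; ring. Qed.

(** For fixed [t] the integrand is monotone in the exponent, in a direction set by the sign of
    [ln t], so one endpoint already dominates. *)
Lemma gamma_fun_le_endpoints x y z t : x <= y -> y <= z -> 0 < t ->
  gamma_fun y t <= gamma_fun x t + gamma_fun z t.
Proof.
move=> xy yz t0; have [l0|l0] := leP 0 (ln t).
- apply: (@le_trans _ _ (gamma_fun z t)); last by rewrite lerDr gamma_fun_ge0.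
  by rewrite !gamma_funE// ler_expR lerD2r ler_wpM2r//; lra.
- apply: (@le_trans _ _ (gamma_fun x t)); last by rewrite lerDl gamma_fun_ge0.
  by rewrite !gamma_funE// ler_expR lerD2r ler_wnM2r ?(ltW l0)//; lra.
Qed.

Lemma normr_le_expR x : `|x| <= expR x + expR (- x).
Proof.
rewrite ler_norml; have := expR_ge1Dx x; have := expR_ge1Dx (- x).
by have := expR_ge0 x; have := expR_ge0 (- x); lra.
Qed.

(* |ln t| <= (t^e + t^-e) / e with e = x/4, so that t^(y-1) |ln t| is
   controlled by t^(x/2-1) + t^(3x/2-1) for |y - x| <= e. *)
Definition ln_gamma_bound x t : R :=
  (x / 4)^-1 * 2 * (gamma_fun (x / 2) t + gamma_fun (x + x / 2) t).

(** Multiplying by [t] to the power [x / 4] or [- (x / 4)] moves the exponent to [y + x / 4] or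
    [y - x / 4], both within [[x / 2, x + x / 2]]; each is dominated by the endpoint sum, whence the
    factor 2. *)
Lemma ln_gamma_fun_le x y t : 0 < x -> x - x / 4 <= y <= x + x / 4 -> 0 < t ->
  `|ln t * gamma_fun y t| <= ln_gamma_bound x t.
Proof.
move=> x0 /andP[yx xy] t0; have e0 : 0 < x / 4 by lra.
rewrite normrM (ger0_norm (gamma_fun_ge0 _ _)) /ln_gamma_bound -mulrA.
rewrite ler_pdivlMl// mulrA.
have -> : x / 4 * `|ln t| = `|x / 4 * ln t|.
  by rewrite normrM (ger0_norm (ltW e0)).
apply: (le_trans (ler_wpM2r (gamma_fun_ge0 _ _) (normr_le_expR _))).
rewrite mulrDl -mulNr -!gamma_funD//.
have := @gamma_fun_le_endpoints (x / 2) (y + x / 4) (x + x / 2) t.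
have := @gamma_fun_le_endpoints (x / 2) (y + - (x / 4)) (x + x / 2) t.
by move=> /(_ ltac:(lra) ltac:(lra) t0) + /(_ ltac:(lra) ltac:(lra) t0); lra.
Qed.

Lemma integrable_ln_gamma_bound x : 0 < x ->
  mu.-integrable Rpos (EFin \o ln_gamma_bound x).
Proof.
move=> x0.
have i1 := @integrable_gamma_fun R (x / 2) ltac:(lra).
have i2 := @integrable_gamma_fun R (x + x / 2) ltac:(lra).
exact: (@integrableZl _ _ _ mu _ (measurable_itv _) _ _
  (@integrableD _ _ _ mu _ (measurable_itv _) _ _ i1 i2)).
Qed.

Lemma integrable_ln_gamma_fun x : 0 < x ->
  mu.-integrable Rpos (EFin \o (fun t => ln t * gamma_fun x t)).
Proof.
move=> x0; apply: (@le_integrable _ _ _ mu _ (measurable_itv _) _ _ _ _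
  (integrable_ln_gamma_bound x0)).
- apply/measurable_EFinP; apply: measurable_funM.
    by apply: measurable_funTS; exact: measurable_ln.
  exact: measurable_gamma_fun.
- move=> t /=; rewrite in_itv/= andbT => t0.
  rewrite lee_fin; apply: le_trans (ler_norm _).
  by apply: ln_gamma_fun_le => //; lra.
Qed.

Lemma is_derive_gamma_fun_exponent x t : 0 < t ->
  is_derive x 1 (gamma_fun ^~ t) (ln t * gamma_fun x t).
Proof.
move=> t0; have -> : gamma_fun ^~ t = fun x => expR ((x - 1) * ln t - t).
  by apply/funext => y; rewrite gamma_funE.
have h : is_derive x 1 (fun y : R => (y - 1) * ln t - t) (ln t).
  have h : is_derive x 1 (fun y : R => ln t * (y - 1) - t) _ :=
    is_deriveB (is_deriveZ (ln t) (is_deriveB (is_derive_id x 1)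
      (is_derive_cst (1 : R) x 1))) (is_derive_cst t x 1).
  have -> : (fun y : R => (y - 1) * ln t - t) = fun y => ln t * (y - 1) - t.
    by apply/funext => y; rewrite mulrC.
  by apply: is_derive_eq; rewrite !subr0 /GRing.scale/= mulr1.
have := @is_derive1_comp R expR (fun y => (y - 1) * ln t - t) x _ _
  (is_derive_expR _) h.
by rewrite gamma_funE// mulrC.
Qed.

(** Differentiation under the integral sign, with [ln_gamma_bound x] dominating the derivative for
    all exponents within [x / 4] of [x]. *)
Lemma is_derive_Gamma x : 0 < x ->
  is_derive x 1 Gamma (\int[mu]_(t in Rpos) (ln t * gamma_fun x t)).
Proof.
move=> x0; pose u := x - x / 4; pose v := x + x / 4.
have Ix : `]u, v[%classic x by rewrite /= in_itv/= /u /v; apply/andP; lra.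
have I0 y : `]u, v[%classic y -> 0 < y.
  by rewrite /= in_itv/= /u /v => /andP[? ?]; lra.
have intf y : `]u, v[%classic y -> mu.-integrable Rpos (EFin \o gamma_fun y).
  by move=> /I0; exact: integrable_gamma_fun.
have derf y t : `]u, v[%classic y -> Rpos t ->
    derivable (fun z => gamma_fun z t) y 1.
  rewrite /= !in_itv/= andbT => _ t0.
  by have [] := is_derive_gamma_fun_exponent y t0.
have dE y t : 0 < t -> partial1of2 (@gamma_fun R) y t = ln t * gamma_fun y t.
  move=> t0; rewrite partial1of2E.
  by have /@derive_val := is_derive_gamma_fun_exponent y t0.
have B0 t : 0 <= ln_gamma_bound x t.
  by rewrite mulr_ge0 ?addr_ge0 ?gamma_fun_ge0// mulr_ge0// invr_ge0; lra.
have B_ub y t : `]u, v[%classic y -> Rpos t ->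
    `|partial1of2 (@gamma_fun R) y t| <= ln_gamma_bound x t.
  rewrite /= !in_itv/= andbT => /andP[uy yv] t0; rewrite dE//.
  by apply: ln_gamma_fun_le => //; rewrite (ltW uy) (ltW yv).
have dG := @derivable_under_integral R _ _ mu (@gamma_fun R) _
  (measurable_itv _) x u v Ix intf derf _ B0 (integrable_ln_gamma_bound x0)
  B_ub.
apply: DeriveDef; first exact: dG.
rewrite -derive1E.
rewrite (@differentiation_under_integral R _ _ mu (@gamma_fun R) _
  (measurable_itv _) x u v Ix intf derf _ B0 (integrable_ln_gamma_bound x0)
  B_ub).
by apply: eq_Rintegral => t /[!inE]/=; rewrite in_itv/= andbT => t0; rewrite dE.
Qed.

(** Thus [digamma x] is the mean of [ln t] for the density [gamma_fun x / Gamma x]. *)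
Lemma digammaE x : 0 < x ->
  digamma x * Gamma x = \int[mu]_(t in Rpos) (ln t * gamma_fun x t).
Proof.
move=> x0; rewrite /digamma mulfVK ?gt_eqF ?Gamma_gt0// derive1E.
by have /@derive_val := is_derive_Gamma x0.
Qed.

(** * Monotonicity and recurrence of the digamma function *)

Lemma Gamma_tangent x s : 0 < x -> 0 < x + s ->
  Gamma x * expR (s * digamma x) <= Gamma (x + s).
Proof.
move=> x0 xs0; set c := digamma x.
(* Integrate e^u >= 1 + u for u = s * (ln t - c): the choice of c cancels the
   first-order term. *)
pose p := expR (s * c) * (1 - s * c); pose q := expR (s * c) * s.
have i1 : mu.-integrable Rpos (EFin \o (fun t => p * gamma_fun x t)).
  exact: (@integrableZl _ _ _ mu Rpos (measurable_itv _) p _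
    (integrable_gamma_fun x0)).
have i2 : mu.-integrable Rpos (EFin \o (fun t => q * (ln t * gamma_fun x t))).
  exact: (@integrableZl _ _ _ mu Rpos (measurable_itv _) q _
    (integrable_ln_gamma_fun x0)).
have -> : Gamma x * expR (s * c) =
    \int[mu]_(t in Rpos) (p * gamma_fun x t + q * (ln t * gamma_fun x t)).
  rewrite (@RintegralD _ _ R mu Rpos) //.
  rewrite (@RintegralZl _ _ R mu Rpos) //; last exact: integrable_gamma_fun.
  rewrite (@RintegralZl _ _ R mu Rpos) //; last exact: integrable_ln_gamma_fun.
  by rewrite -digammaE// -GammaE /p /q -/c; ring.
rewrite [leRHS]GammaE; apply: (@le_Rintegral _ _ R mu Rpos) => //.
- exact: (@integrableD _ _ _ mu _ (measurable_itv _) _ _ i1 i2).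
- exact: integrable_gamma_fun.
- move=> t /=; rewrite in_itv/= andbT => t0.
  rewrite gamma_funD// mulrA -mulrDl ler_wpM2r ?gamma_fun_ge0//.
  have -> : expR (s * ln t) = expR (s * c) * expR (s * (ln t - c)).
    by rewrite -expRD; congr expR; ring.
  rewrite /p /q -mulrA -mulrDr ler_wpM2l ?expR_ge0//.
  by apply: le_trans (expR_ge1Dx _); lra.
Qed.

(** Chaining the tangent inequality from [x] to [y] with the one from [y] to [x] and cancelling
    [Gamma x] leaves [expR ((y - x) * (digamma x - digamma y)) <= 1]. *)
Lemma digamma_le x y : 0 < x -> x <= y -> digamma x <= digamma y.
Proof.
move=> x0; rewrite le_eqVlt => /predU1P[->//|xy]; have y0 : 0 < y by lra.
have := @Gamma_tangent x (y - x) x0; have := @Gamma_tangent y (x - y) y0.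
rewrite !(addrC _ (_ - _)) !subrK => /(_ x0) h1 /(_ y0) h2.
move: h1 h2 (Gamma_gt0 x0).
move: (digamma x) (digamma y) (Gamma x) (Gamma y) => p q Gx Gy h1 h2 Gx0.
have := le_trans (ler_wpM2r (expR_ge0 ((x - y) * q)) h2) h1.
rewrite -mulrA -expRD (ger_pMr _ Gx0) -[leRHS]expR0 ler_expR => h.
have : (y - x) * (p - q) <= 0 by lra.
by rewrite pmulr_rle0 ?subr_gt0// subr_le0.
Qed.

(** Logarithmic derivative of [Gamma (y + 1) = y * Gamma y], an identity available for positive [y]
    and hence near [x]. *)
Lemma digamma1D x : 0 < x -> digamma (x + 1) = digamma x + x^-1.
Proof.
move=> x0; have x10 : 0 < x + 1 by lra.
have derG y : 0 < y -> is_derive y 1 Gamma (digamma y * Gamma y).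
  by move=> y0; rewrite digammaE//; exact: is_derive_Gamma.
have d1 : is_derive x 1 (fun y : R => y * Gamma y) _ :=
  is_deriveM (is_derive_id x 1) (derG _ x0).
have d2 : is_derive x 1 (fun y : R => Gamma (y + 1)) _ :=
  @is_derive1_comp R Gamma (fun y => y + 1) x _ _ (derG _ x10)
    (is_deriveD (is_derive_id x 1) (is_derive_cst (1 : R) x 1)).
have near1D : \near x, x * Gamma x = Gamma (x + 1).
  by near=> y; rewrite Gamma1D//; near: y; exact: lt_nbhsr.
have d3 := near_eq_is_derive near1D d1.
have /@derive_val := d2; have /@derive_val := d3 => ->.
rewrite /GRing.scale/= Gamma1D// => h; have G0 := Gamma_gt0 x0.
have G1 : Gamma x != 0 by rewrite gt_eqF.
have x1 : x != 0 by rewrite gt_eqF.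
apply: (@mulIf _ (x * Gamma x)); first by rewrite mulf_neq0.
move: h; rewrite addr0 !mulr1 => <-; field.
by rewrite x1.
Unshelve. all: by end_near. Qed.

Lemma digammaDn x n : 0 < x ->
  digamma (x + n%:R) = digamma x + \sum_(k < n) (x + k%:R)^-1.
Proof.
move=> x0; elim: n => [|n IHn]; first by rewrite big_ord0 !addr0.
rewrite big_ord_recr/= addrA -IHn -natr1 addrA digamma1D//.
by rewrite ltr_pwDl.
Qed.

End Digamma.

(** * The ratio of hyperharmonic numbers and rising factorials *)

Section HyperharmonicRatio.
Context {R : realType}.
Implicit Types (r x y : R) (n : nat).

Definition digamma_slope r x : R := (digamma (x + r) - digamma r) / x.

(** Expanding both digamma values by [digammaDn] and splitting into partial fractions, the partial
    sum equals the slope minus [e n / x]. *)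
Lemma digamma_slope_cvg r x : 0 < r -> 0 < x ->
  \sum_(k < n.+1) ((r + k%:R) * (x + r + k%:R))^-1 @[n --> \oo] -->
  digamma_slope r x.
Proof.
move=> r0 x0; have xr0 : 0 < x + r by rewrite addr_gt0.
(* Replacing [x] by an integer [m >= x] lets monotonicity and [digammaDn] bound [e n] by a sum of
   [m] terms, each at most [n.+1%:R^-1]. *)
have [m xm] : exists m : nat, x <= m%:R.
  by exists (Num.truncn x).+1; apply/ltW; rewrite truncnS_gt.
pose e n := digamma (x + r + n.+1%:R) - digamma (r + n.+1%:R).
have e0 : e n @[n --> \oo] --> 0.
  apply: (@squeeze_cvgr _ _ _ _ (cst 0) (fun n => m%:R * n.+1%:R^-1)).
  - near=> n; have rn0 : 0 < r + n.+1%:R by rewrite addr_gt0.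
    rewrite /cst /e subr_ge0 digamma_le//=; last by rewrite lerD2r lerDr ltW.
    have le1 : x + r + n.+1%:R <= r + n.+1%:R + m%:R by lra.
    have xrn0 : 0 < x + r + n.+1%:R by rewrite addr_gt0.
    have := digamma_le xrn0 le1.
    rewrite (digammaDn _ rn0) => le2; rewrite lerBlDl (le_trans le2)// lerD2l.
    apply: (@le_trans _ _ (\sum_(k < m) n.+1%:R^-1)); last first.
      by rewrite sumr_const card_ord mulr_natl.
    apply: ler_sum => k _.
    have k0 : 0 <= k%:R :> R by [].
    have le3 : n.+1%:R <= r + n.+1%:R + k%:R.
      by rewrite addrAC lerDr addr_ge0 ?(ltW r0).
    by rewrite lef_pV2 ?posrE ?ltr0n// (lt_le_trans _ le3) ?ltr0n.
  - exact: cvg_cst.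
  - by rewrite -[X in _ --> X](mulr0 m%:R); apply: cvgMl_tmp; exact: cvg_invSn.
have : digamma_slope r x - e n / x @[n --> \oo] --> digamma_slope r x - 0 / x.
  by apply: cvgB; [exact: cvg_cst|apply: cvgMr_tmp].
rewrite mul0r subr0; apply: cvg_trans; apply: near_eq_cvg; near=> n.
rewrite /digamma_slope /e -mulrBl !digammaDn//.
set sx := \sum_(k < n.+1) _; set sr := \sum_(k < n.+1) _.
have -> : digamma (x + r) - digamma r -
    (digamma (x + r) + sx - (digamma r + sr)) = sr - sx.
  by move: (digamma _) (digamma _) => p q; ring.
rewrite -sumrB mulr_suml; apply: eq_bigr => k _.
have rk0 : r + k%:R != 0 by rewrite gt_eqF// ltr_pwDl.
have xrk0 : x + r + k%:R != 0 by rewrite gt_eqF// ltr_pwDl.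
field; by rewrite rk0 xrk0 gt_eqF.
Unshelve. all: by end_near. Qed.

Lemma digamma_slope_lt r x y : 0 < r -> 0 < x -> x < y ->
  digamma_slope r y < digamma_slope r x.
Proof.
move=> r0 x0 xy; have y0 := lt_trans x0 xy.
pose T z n : R := ((r + n%:R) * (z + r + n%:R))^-1.
have T_lt n : T y n < T x n.
  have n0 : 0 <= n%:R :> R by [].
  have den z : 0 < z -> 0 < (r + n%:R) * (z + r + n%:R).
    by move=> z0; rewrite mulr_gt0//; lra.
  rewrite /T ltf_pV2 ?posrE ?den//.
  by rewrite ltr_pM2l ?ltrD2r//; lra.
(* Termwise comparison is only weak in the limit; setting aside the first term keeps a positive
   gap. *)
rewrite -subr_gt0; apply: (@lt_le_trans _ _ (T x 0%N - T y 0%N)).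
  by rewrite subr_gt0.
apply: (cvgr_to_ge (cvgB (digamma_slope_cvg r0 x0) (digamma_slope_cvg r0 y0))).
near=> n; rewrite !fctE !big_ord_recl/= opprD addrACA lerDl subr_ge0.
by apply: ler_sum => k _; exact/ltW/T_lt.
Unshelve. all: by end_near. Qed.

(** At a positive integer [n] the slope is the arithmetic mean of the first [n] numbers
    [(r + k)^-1], which tend to 0, so Cesàro's theorem applies. *)
Lemma digamma_slope_cvg0 r : 0 < r -> digamma_slope r n%:R @[n --> \oo] --> 0.
Proof.
move=> r0; rewrite -cvg_shiftS.
have u0 : (r + n%:R)^-1 @[n --> \oo] --> 0.
  rewrite -cvg_shiftS /=.
  apply: (@squeeze_cvgr _ _ _ _ (cst 0) (fun n => n.+1%:R^-1)).
  - near=> n; rewrite /cst invr_ge0 (addr_ge0 (ltW r0))//=.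
    by rewrite lef_pV2 ?posrE ?addr_gt0// lerDr (ltW r0).
  - exact: cvg_cst.
  - exact: cvg_invSn.
apply: cvg_trans (cesaro u0); apply: near_eq_cvg; near=> n.
rewrite /arithmetic_mean /= /digamma_slope (addrC _ r) digammaDn//.
by rewrite addrAC subrr add0r mulrC /series/= big_mkord.
Unshelve. all: by end_near. Qed.

(** * Monotonicity and decay of [hratio], and comparison of consecutive orders *)

Lemma hratioE r x : 0 < r -> 0 < x -> hratio r x = digamma_slope r x / Gamma r.
Proof.
move=> r0 x0; rewrite /hratio /hyperharmonic gt_eqF// /digamma_slope.
have : rising x r != 0.
  by rewrite /rising mulf_neq0 ?invr_eq0// gt_eqF ?Gamma_gt0// addr_gt0.
have := Gamma_gt0 r0.
move: (digamma _) (digamma _) (Gamma _) (rising _ _) => p q G s G0 s0.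
by field; rewrite s0 !gt_eqF.
Qed.

Lemma hratio0 x : 0 < x -> hratio 0 x = x^-1.
Proof.
move=> x0; rewrite /hratio /hyperharmonic eqxx /rising addr0.
by rewrite divff ?gt_eqF ?Gamma_gt0// divr1.
Qed.

Lemma hratio_decreasing r : 0 <= r -> decreasing_from1 (hratio r).
Proof.
rewrite le_eqVlt => /predU1P[<-|r0] x y x1 xy.
all: have x0 : 0 < x := lt_le_trans ltr01 x1; have y0 := lt_trans x0 xy.
- by rewrite !hratio0// ltf_pV2.
- by rewrite !hratioE// ltr_pM2r ?invr_gt0 ?Gamma_gt0// digamma_slope_lt.
Qed.

Lemma hratio_cvg0 r : 0 <= r -> hratio r n%:R @[n --> \oo] --> 0.
Proof.
move=> r0; rewrite -cvg_shiftS; move: r0.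
rewrite le_eqVlt => /predU1P[<-|r0].
- apply: cvg_trans cvg_invSn; apply: near_eq_cvg; near=> n.
  by rewrite /= hratio0.
- have h : digamma_slope r n.+1%:R / Gamma r @[n --> \oo] --> 0 / Gamma r.
    apply: cvgMr_tmp.
    rewrite (cvg_shiftS (fun n => digamma_slope r n%:R)).
    exact: digamma_slope_cvg0.
  rewrite mul0r in h; apply: cvg_trans h; apply: near_eq_cvg; near=> n.
  by rewrite /= hratioE.
Unshelve. all: by end_near. Qed.

(** This is the first term of [b_seq], hence the upper bound for the whole sequence. *)
Lemma hratio1 r : 0 <= r -> hratio r 1 = 1 / Gamma (r + 1).
Proof.
rewrite le_eqVlt => /predU1P[<-|r0].
  by rewrite hratio0// add0r Gamma1 invr1 mulr1.
rewrite (hratioE r0 ltr01) /digamma_slope (addrC 1 r).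
rewrite (digamma1D r0) (Gamma1D r0) addrAC subrr add0r.
by rewrite divr1 div1r invfM.
Qed.

(** Raising [r] by 1 changes the digamma difference by [(x + r)^-1 - r^-1 = - x / (r * (x + r))],
    whose factor [x] cancels the denominator of the slope. *)
Lemma hratio_sub_succ r x : 0 < r -> 0 < x ->
  hratio r x - hratio (r + 1) x =
  ((1 - r^-1) * digamma_slope r x + (r ^+ 2 * (x + r))^-1) / Gamma r.
Proof.
move=> r0 x0; have r10 : 0 < r + 1 by rewrite addr_gt0.
have xr0 : 0 < x + r by rewrite addr_gt0.
rewrite !hratioE// /digamma_slope addrA !digamma1D// Gamma1D//.
move: (digamma _) (digamma _) (Gamma r) (Gamma_gt0 r0) => p q G G0.
by field; rewrite !gt_eqF.
Qed.

(** The condition [1 <= r] makes the coefficient [1 - r^-1] nonnegative. It vanishes at [r = 1], so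
    strictness is taken from the second term. *)
Lemma hratio_sub_succ_decreasing r : 1 <= r ->
  decreasing_from1 (fun x => hratio r x - hratio (r + 1) x).
Proof.
move=> r1 x y x1 xy; have r0 : 0 < r := lt_le_trans ltr01 r1.
have x0 : 0 < x := lt_le_trans ltr01 x1; have y0 := lt_trans x0 xy.
rewrite (hratio_sub_succ r0 x0) (hratio_sub_succ r0 y0).
rewrite ltr_pM2r ?invr_gt0 ?Gamma_gt0//.
rewrite ler_ltD//.
  rewrite ler_wpM2l ?subr_ge0 ?invf_le1//.
  by rewrite ltW// digamma_slope_lt.
rewrite ltf_pV2 ?posrE ?mulr_gt0 ?exprn_gt0 ?addr_gt0//.
by rewrite ltr_pM2l ?exprn_gt0// ltrD2r.
Qed.

Lemma gamma_hE r : gamma_h r = lim (lower_seq (hratio r) @ \oo).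
Proof. by []. Qed.

Lemma gamma_h_succ_lt r : 1 <= r -> gamma_h (r + 1) < gamma_h r.
Proof.
move=> r1; have r0 : 0 <= r by lra.
have r10 : 0 <= r + 1 by lra.
apply: (lim_lower_seq_lt (hratio_decreasing r0) (hratio_decreasing r10)
  (hratio_sub_succ_decreasing r1)); exact: hratio_cvg0.
Qed.

End HyperharmonicRatio.

(** The infinite chain of (a) is expressed by consecutive inequalities together with the comparison
    of every [a_seq r m] with every [b_seq r n]. *)
Theorem theorem2 (R : realType) (r : R) (hr : 0 <= r) :
  [/\ (* (a) *)
      (forall n : nat, (1 <= n)%N ->
         [/\ 0 <= a_seq r n, a_seq r n < a_seq r n.+1,
             b_seq r n.+1 < b_seq r n & b_seq r n <= 1 / Gamma (r + 1)]) /\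
      (forall m n : nat, (1 <= m)%N -> (1 <= n)%N -> a_seq r m < b_seq r n),
      (* (b) *)
      (a_seq r n @[n --> \oo] --> gamma_h r) /\
      (b_seq r n @[n --> \oo] --> gamma_h r),
      (* (c) *)
      forall n : nat, (1 <= n)%N ->
        (C_gap n r < gamma_h r - a_seq r n <
           C_gap n r + hratio r n.+1%:R) /\
        (D_gap n r - hratio r n.+1%:R < b_seq r n - gamma_h r < D_gap n r)
    & (* (d) *)
      1 <= r -> gamma_h (r + 1) < gamma_h r].
Proof.
have df := hratio_decreasing hr; have f0 := hratio_cvg0 hr.
have aE n : a_seq r n = lower_seq (hratio r) n by [].
have bE n : b_seq r n = upper_seq (hratio r) n by [].
split; [split=> [n n1|m n m1 n1]|split|move=> n n1|].
- split.
  + by rewrite aE -(lower_seq1 (hratio r)) lower_seq_le.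
  + by rewrite !aE lower_seq_lt.
  + by rewrite !bE upper_seq_lt.
  + rewrite bE -hratio1// (le_trans (upper_seq_le df (leqnn 1) n1))//.
    by rewrite upper_seqE// lower_seq1 add0r.
- by rewrite aE bE lower_lt_upper.
- exact: lower_seq_cvg.
- exact: upper_seq_cvg.
(* All four bounds restate [a_seq r n.+1 < gamma_h r < b_seq r n.+1], since
   [a_seq r n.+1 = a_seq r n + C_gap n r] and [b_seq r n.+1] exceeds it by [hratio r n.+1%:R]. *)
- have aS := lower_seqS df n1.
  have := lower_seq_lt_lim df f0 (leqW n1).
  have := lim_lt_upper_seq df f0 (leqW n1).
  rewrite aE bE gamma_hE /C_gap /D_gap /hratio_int !upper_seqE// aS.
  by move: (lim _) (lower_seq _ _) (\int[_]_(_ in _) _) (hratio _ _)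
    (hratio _ _) => l a i u v; split; lra.
- exact: gamma_h_succ_lt.
Qed.
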